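(* Let $n$ and $\sigma$ be integers with $2 \leq \sigma < \frac{n}{2}$. There is no deterministic algorithm that performs at most $\frac{n\sigma}{8}$ equality comparisons in the worst case and is able to distinguish length-$n$ strings with at most $\sigma$ distinct symbols from length-$n$ strings with at least $\frac{n}{2}$ distinct symbols.
   Context: The algorithm accesses the input string $T[1..n]$ over a general unordered alphabet only through queries ''is $T[i]=T[j]$?''; each query counts as one equality comparison. *)

(* Defs.v *)
From mathcomp Require Import all_boot.

Set Implicit Arguments.
Unset Strict Implicit.
Unset Printing Implicit Defensive.

(* A deterministic algorithm on inputs of a fixed length n that sees its input
   only through equality tests, as an adaptive decision tree: [Compare i j yes
   no] asks whether T[i] = T[j] and continues according to the answer.
   The tree does not mention the alphabet; positions are 0-based. *)
Inductive algorithm (n : nat) : Type :=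
| Answer of bool
| Compare of 'I_n & 'I_n & algorithm n & algorithm n.

Arguments Answer {n}.

Section Runs.

Variables (A : eqType) (n : nat).
Implicit Types (P : algorithm n) (T : n.-tuple A).

Fixpoint output P T : bool :=
  match P with
  | Answer b => b
  | Compare i j yes no =>
      if tnth T i == tnth T j then output yes T else output no T
  end.

(* Every test on the branch taken counts, including repeated and trivial ones. *)
Fixpoint comparisons P T : nat :=
  match P with
  | Answer _ => 0
  | Compare i j yes no =>
      (if tnth T i == tnth T j then comparisons yes T else comparisons no T).+1
  end.

Definition distinct_symbols T : nat := size (undup T).

(* Promise problem: nothing is required of the output on strings whose number
   of distinct symbols lies strictly between sigma and n / 2. *)
Definition distinguishes (sigma : nat) P : Prop :=
  forall T,
    (distinct_symbols T <= sigma -> output P T = true) /\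
    (n <= 2 * distinct_symbols T -> output P T = false).

(* Comparison count at most n * sigma / 8 (exact, not floored) on every string
   of length n, promised or not. *)
Definition worst_case_at_most_eighth (sigma : nat) P : Prop :=
  forall T, 8 * comparisons P T <= n * sigma.

End Runs.

Arguments distinguishes A {n} sigma P.
Arguments worst_case_at_most_eighth A {n} sigma P.

Definition infinite_alphabet (A : eqType) : Prop :=
  forall s : seq A, exists x : A, x \notin s.

(* Main.v *)
Require Import Defs.
From mathcomp Require Import all_boot.
From mathcomp Require Import zify.

(* Adversary argument.  The adversary keeps the list of pairs it has declared
   different and a partial colouring of the positions by a palette of sigma
   symbols.  It answers "different" as long as one of the two positions is
   uncoloured; a position is coloured, avoiding the colours of the positions
   already declared different from it, only once it lies in sigma - 1 declared
   pairs.  With at most n * sigma / 8 comparisons at most half of the positions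
   get coloured.  The uncoloured ones can then be completed either greedily
   inside the palette or by pairwise distinct fresh symbols, and both
   completions agree with every answer given. *)

Set Implicit Arguments.
Unset Strict Implicit.
Unset Printing Implicit Defensive.

Section Adversary.

Variables (A : eqType) (n : nat).
Implicit Types (i j : 'I_n) (e : 'I_n * 'I_n) (E : seq ('I_n * 'I_n)).
Implicit Types (c d : 'I_n -> option A) (T : n.-tuple A) (pal : seq A).

Definition incident i e := (e.1 == i) || (e.2 == i).

Definition degree E i := count (incident i) E.

Definition extends c d := forall i a, c i = Some a -> d i = Some a.

Definition consistent E c T :=
  (forall i a, c i = Some a -> tnth T i = a) /\
  (forall e, e \in E -> tnth T e.1 <> tnth T e.2).

(** A partial proper colouring of the graph of declared pairs. The last field is the invariant that
    keeps a palette colour available to each uncoloured position. *)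
Record colouring pal E c : Prop := Colouring {
  loopless : forall e, e \in E -> e.1 != e.2;
  proper : forall e a, e \in E -> c e.1 = Some a -> c e.2 <> Some a;
  in_palette : forall i a, c i = Some a -> a \in pal;
  uncoloured_degree : forall i, c i = None -> degree E i < size pal }.

(** Every coloured position has been paid for by [k] declared pairs, so few comparisons colour few
    positions. *)
Definition coloured_heavy k E c := forall i, c i -> k <= degree E i.

Lemma consistent_extends E c d T :
  extends c d -> consistent E d T -> consistent E c T.
Proof. by move=> cd [dT ET]; split=> // i a /cd; apply: dT. Qed.

Lemma free_colour pal E c i :
  uniq pal -> degree E i < size pal ->
  exists2 a, a \in pal & forall e, e \in E ->
    (e.1 = i -> c e.2 <> Some a) /\ (e.2 = i -> c e.1 <> Some a).
Proof.
move=> pal_uniq deg_i.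
(* Pigeonhole: the colours at the other ends of the pairs meeting [i] number at most its degree, so
   they cannot exhaust the palette. *)
pose used := pmap (fun e => c (if e.1 == i then e.2 else e.1))
               [seq e <- E | incident i e].
have used_lt : size used < size pal.
  apply: leq_ltn_trans deg_i.
  by rewrite size_pmap (leq_trans (count_size _ _)) // size_filter.
have /allPn[a a_pal a_free] : ~~ all [in used] pal.
  apply/negP => /allP /(uniq_leq_size pal_uniq); by rewrite leqNgt used_lt.
exists a => // e eE; split=> ei cea; case/negP: a_free;
  rewrite /= mem_pmap; apply/mapP; exists e;
  rewrite ?mem_filter ?eE /incident ?ei ?eqxx ?orbT //=.
by case: eqP => // e1i; rewrite -cea e1i.
Qed.

Lemma colour_position pal E c i :
  uniq pal -> colouring pal E c -> c i = None ->
  exists2 d, colouring pal E d &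
    [/\ extends c d, d i & forall j, j != i -> d j = c j].
Proof.
move=> pal_uniq [loop prop pal_c deg_c] ci.
have [a a_pal a_free] := free_colour c pal_uniq (deg_c _ ci).
exists [eta c with i |-> Some a] => /=; last first.
  by split=> [j b cj||j /negPf ->] //=; rewrite ?eqxx //; case: eqP cj => // ->; rewrite ci.
split=> //= [e b eE|j b|j].
- have [free1 free2] := a_free e eE; have := loop e eE.
  case: (e.1 =P i) => [e1i|_]; case: (e.2 =P i) => [e2i|_].
  + by rewrite e1i e2i eqxx.
  + by move=> _ [<-]; apply: free1.
  + by move=> _ cb [ab]; apply: free2 e2i _; rewrite ab.
  + by move=> _; apply: prop.
- by case: eqP => [_ [<-]|_ /pal_c].
- by case: eqP => // _ /deg_c.
Qed.

(** The threshold is one below the palette size: an uncoloured position of that degree still has a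
    free colour, but might lose it with one more declared pair. *)
Lemma saturate pal E c i :
  uniq pal -> colouring pal E c -> coloured_heavy (size pal).-1 E c ->
  exists d, [/\ colouring pal E d, coloured_heavy (size pal).-1 E d,
    extends c d & d i \/ degree E i < (size pal).-1].
Proof.
move=> pal_uniq col_c heavy_c.
case: (ltnP (degree E i) (size pal).-1) => [deg_i|deg_i].
  by exists c; split=> //; right.
case ci: (c i) => [a|]; first by exists c; split=> //; left; rewrite ci.
have [d col_d [cd di dj]] := colour_position pal_uniq col_c ci.
exists d; split=> //; last by left.
by move=> j; case: (eqVneq j i) => [->|/dj ->] // /heavy_c.
Qed.

Lemma colouring_cons pal E c i j :
  colouring pal E c -> i != j -> ~~ (c i && c j) ->
  (c i \/ degree E i < (size pal).-1) -> (c j \/ degree E j < (size pal).-1) ->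
  colouring pal ((i, j) :: E) c.
Proof.
move=> [loop prop pal_c deg_c] ij cij satur_i satur_j; split=> //.
- by move=> e; rewrite inE => /predU1P[->|/loop].
- move=> e a; rewrite inE => /predU1P[->|/prop] /=; last exact.
  by move=> ci cj; move: cij; rewrite ci cj.
- move=> x cx; have := deg_c x cx; rewrite /degree /= /incident /=.
  case: (eqVneq i x) => [ix|_] /=.
    by move: satur_i; rewrite ix cx /degree /incident; case=> //; lia.
  case: (eqVneq j x) => [jx|_] //=.
  by move: satur_j; rewrite jx cx /degree /incident; case=> //; lia.
Qed.

(** Induction on the tree. The output [b] is fixed before [T], so all strings consistent with the
    final state are indistinguishable to [P]. *)
Lemma adversary pal (P : algorithm n) E c :
  uniq pal -> colouring pal E c -> coloured_heavy (size pal).-1 E c ->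
  exists F d b, [/\ colouring pal F d, coloured_heavy (size pal).-1 F d &
    forall T, consistent F d T ->
      [/\ consistent E c T, output P T = b &
          size F <= size E + comparisons P T]].
Proof.
move=> pal_uniq; elim: P E c => [b|i j yes IHyes no IHno] E c col_c heavy_c.
  by exists E, c, b; split=> // T; rewrite addn0.
case: (eqVneq i j) => [<-|ij].
  have [F [d [b [col_d heavy_d run]]]] := IHyes E c col_c heavy_c.
  exists F, d, b; split=> // T /run[Tc out cmp]; rewrite /= eqxx; split=> //.
  by rewrite addnS leqW.
have [c1 [col1 heavy1 c_c1 sat_i1]] := saturate i pal_uniq col_c heavy_c.
have [c2 [col2 heavy2 c1_c2 sat_j]] := saturate j pal_uniq col1 heavy1.
have c_c2 : extends c c2 by move=> x a /c_c1/c1_c2.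
have sat_i : c2 i \/ degree E i < (size pal).-1.
  case: sat_i1 => [|?]; last by right.
  by case c1i: (c1 i) => [a|] // _; left; rewrite (c1_c2 _ _ c1i).
(* Two coloured positions: the colours force the answer, and no pair is recorded. *)
case: (boolP (c2 i && c2 j)) => [|cij].
  case ci: (c2 i) => [a|//]; case cj: (c2 j) => [a'|//] _.
  have [aa'|aa'] := eqVneq a a'.
    have [F [d [b [col_d heavy_d run]]]] := IHyes E c2 col2 heavy2.
    exists F, d, b; split=> // T /run[Tc out cmp].
    have [Tc2 _] := Tc; rewrite /= (Tc2 _ _ ci) (Tc2 _ _ cj) aa' eqxx.
    by split; [apply: consistent_extends c_c2 Tc | | rewrite addnS leqW].
  have [F [d [b [col_d heavy_d run]]]] := IHno E c2 col2 heavy2.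
  exists F, d, b; split=> // T /run[Tc out cmp].
  have [Tc2 _] := Tc; rewrite /= (Tc2 _ _ ci) (Tc2 _ _ cj) (negPf aa').
  by split; [apply: consistent_extends c_c2 Tc | | rewrite addnS leqW].
(* One end is uncoloured: the answer is no, and the pair is recorded, at the cost of one
   comparison. *)
have col3 := colouring_cons col2 ij cij sat_i sat_j.
have heavy3 : coloured_heavy (size pal).-1 ((i, j) :: E) c2.
  by move=> x /heavy2 le_k; apply: leq_trans le_k (leq_addl _ _).
have [F [d [b [col_d heavy_d run]]]] := IHno _ c2 col3 heavy3.
exists F, d, b; split=> // T /run[[Tc2 TE] out cmp].
have /eqP/negPf Tij := TE (i, j) (mem_head _ _).
rewrite /= Tij addnS; split=> //.
apply: (consistent_extends c_c2); split=> // e eE.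
by apply: TE; rewrite inE eE orbT.
Qed.

Lemma palette_completion pal E c :
  uniq pal -> colouring pal E c ->
  exists2 T, consistent E c T & distinct_symbols T <= size pal.
Proof.
move=> pal_uniq.
(* Greedy completion, by induction on the number of uncoloured positions. *)
have [m] := ubnP #|[pred i | ~~ c i]|.
elim: m c => // m IHm c lt_m col_c.
have [i /= Nci|all_c] := pickP [pred i | ~~ c i]; last first.
  have c_total i : exists a, c i = Some a.
    by have /= := all_c i; case: (c i) => // a _; exists a.
  have [f c_some] := fin_all_exists c_total.
  exists [tuple f i | i < n].
    split=> [i a ci|e eE]; rewrite !tnth_mktuple.
      by have := c_some i; rewrite ci => -[].
    move=> e12; apply: (proper col_c eE (c_some _)).
    by rewrite e12.
  apply: uniq_leq_size; first exact: undup_uniq.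
  move=> a; rewrite mem_undup => /tnthP[i ->].
  by rewrite tnth_mktuple; apply: (in_palette col_c (c_some i)).
have ci : c i = None by move: Nci; case: (c i).
have [d col_d [cd di dj]] := colour_position pal_uniq col_c ci.
have [|T Td T_pal] := IHm d _ col_d; last first.
  by exists T => //; apply: consistent_extends cd Td.
rewrite -ltnS; apply: leq_trans lt_m; rewrite ltnS; apply: proper_card.
apply/properP; split; last by exists i; rewrite !inE ?ci ?di.
apply/subsetP => j; rewrite !inE.
by case: (eqVneq j i) => [->|/dj ->]; rewrite ?di.
Qed.

Lemma fresh_completion pal E c (fresh : 'I_n -> A) :
  injective fresh -> (forall i, fresh i \notin pal) -> colouring pal E c ->
  exists2 T, consistent E c T & #|[pred i | ~~ c i]| <= distinct_symbols T.
Proof.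
move=> fresh_inj fresh_pal [loop prop pal_c _].
exists [tuple odflt (fresh i) (c i) | i < n].
  split=> [i a ci|e eE]; rewrite !tnth_mktuple ?ci //.
  case c1: (c e.1) => [a|]; case c2: (c e.2) => [b|] /=.
  - by move=> ab; apply: prop eE c1 _; rewrite ab.
  - by move=> afr; have := fresh_pal e.2; rewrite -afr (pal_c _ _ c1).
  - by move=> frb; have := fresh_pal e.1; rewrite frb (pal_c _ _ c2).
  - by move=> /fresh_inj; apply/eqP/loop.
rewrite cardE -(size_map fresh); apply: uniq_leq_size.
  by rewrite map_inj_uniq // enum_uniq.
move=> a /mapP[i]; rewrite mem_enum inE => Nci ->; rewrite mem_undup.
apply/tnthP; exists i; rewrite tnth_mktuple.
by move: Nci; case: (c i).
Qed.

(** Only an inequality, since [incident] counts a loop once. *)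
Lemma handshake E : \sum_i degree E i <= 2 * size E.
Proof.
elim: E => [|e E IHE]; first by rewrite big1.
rewrite /degree /= big_split /= mulnS leq_add //.
apply: (@leq_trans (\sum_i ((i == e.1) + (i == e.2)))).
  by apply: leq_sum => i _; rewrite /incident ![_ == i]eq_sym; do 2 case: eqP.
by rewrite big_split /= -!big_mkcond /= !big_pred1_eq.
Qed.

Lemma card_coloured k E c :
  coloured_heavy k E c -> k * #|[pred i | c i : bool]| <= 2 * size E.
Proof.
move=> heavy_c; apply: leq_trans (handshake E).
rewrite mulnC -sum_nat_const big_mkcond /=; apply: leq_sum => i _.
by case: ifP => // ci; apply: heavy_c; move: ci; rewrite inE.
Qed.

End Adversary.

Lemma infinite_alphabet_uniq (A : eqType) m :
  infinite_alphabet A -> exists2 s : seq A, uniq s & size s = m.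
Proof.
move=> infA; elim: m => [|m [s s_uniq s_size]]; first by exists [::].
by have [x xs] := infA s; exists (x :: s); rewrite /= ?xs ?s_size.
Qed.

Theorem theorem9 (A : eqType) (n sigma : nat) :
  infinite_alphabet A ->
  2 <= sigma -> 2 * sigma < n ->
  ~ exists P : algorithm n,
      worst_case_at_most_eighth A sigma P /\ distinguishes A sigma P.
Proof.
move=> infA sigma_gt1 _ [P [fewP distP]].
(* The first [sigma] symbols form the palette; the other [n] serve as fresh symbols, one per
   position. *)
have [s s_uniq s_size] := infinite_alphabet_uniq (sigma + n) infA.
have [x0 _] := infA [::].
pose pal := take sigma s; pose fresh (i : 'I_n) := nth x0 (drop sigma s) i.
have pal_uniq : uniq pal by apply: take_uniq.
have pal_size : size pal = sigma by rewrite size_takel // s_size leq_addr.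
have drop_size : size (drop sigma s) = n by rewrite size_drop s_size addKn.
have fresh_inj : injective fresh.
  move=> i j /eqP; rewrite nth_uniq ?drop_size ?ltn_ord ?drop_uniq //.
  by move/eqP/val_inj.
have fresh_pal i : fresh i \notin pal.
  move: s_uniq; rewrite -(cat_take_drop sigma s) cat_uniq => /and3P[_ /hasPn + _].
  by apply; rewrite mem_nth // drop_size.
have col0 : colouring pal [::] (fun _ : 'I_n => None).
  by split=> // i _; rewrite pal_size; apply: ltnW.
have heavy0 : coloured_heavy (size pal).-1 [::] (fun _ : 'I_n => None : option A).
  by [].
have [F [d [b [col_d heavy_d run]]]] := adversary P pal_uniq col0 heavy0.
have [T TF few_T] := palette_completion pal_uniq col_d.
have [U UF many_U] := fresh_completion fresh_inj fresh_pal col_d.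
have [_ outT cmpT] := run T TF; have [_ outU _] := run U UF.
(* [T] forces [b] to be true; it remains to see that [U] has enough symbols to force it false. *)
have [+ _] := distP T; rewrite -pal_size outT => /(_ few_T) b_true.
have [_ +] := distP U; rewrite outU b_true; suff n_le : n <= 2 * distinct_symbols U.
  by move/(_ n_le).
(* With [x] coloured positions, [4 * (sigma - 1) * x <= 8 * size F <= n * sigma <= 2 * n * (sigma -
   1)], the last step by [2 <= sigma]. Hence [2 * x <= n], and at least half of the positions are
   uncoloured. *)
apply: (@leq_trans (2 * #|[pred i | ~~ d i]|)); last by rewrite leq_mul2l.
have := card_coloured heavy_d; have := fewP T; rewrite pal_size.
have := cardC [pred i | d i : bool]; rewrite card_ord.
have -> : #|[predC [pred i | d i : bool]]| = #|[pred i | ~~ d i]| by apply: eq_card.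
move: cmpT; rewrite add0n.
move: #|_| #|_| (size F) (comparisons _ _) => x y f k; nia.
Qed.
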